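(* Each of the following two zero-dimensional compact spaces is a Boolean image of a compact connected space but is not a Boolean image of any compact separably connected space: the split interval, and the ordinal interval $[0,\omega_1]$ with its order topology.
   Context: All compact spaces are Hausdorff and nonempty; ''zero-dimensional'' means having a base of clopen sets. The split interval is $[0,1]\times\{0,1\}$ with the lexicographic order and the order topology (with the isolated endpoints $(0,0)$ and $(1,1)$ possibly removed). $K$ is separably connected if every two points of $K$ are contained in a connected separable subspace of $K$. A pseudoclopen of a compact space $K$ is a pair $a=(a^-,a^+)$ with $a^-\subset K$ closed, $a^+\subset K$ open and $a^-\subset a^+$. Let $\mathcal{G}$ be a family of subsets of a nonempty set $X$. A bijection $\phi$ from $\mathcal{G}$ onto a family of pseudoclopens of $K$ is an isomorphism if for all $n,m\ge 0$ and all distinct $a_1,\ldots,a_n,b_1,\ldots,b_m\in\mathcal{G}$: (1) if $\bigcap_{i\le n}a_i\setminus\bigcup_{j\le m}b_j=\emptyset$ then $\bigcap_{i\le n}\phi(a_i)^+\setminus\bigcup_{j\le m}\phi(b_j)^-=\emptyset$; (2) if $\bigcap_{i\le n}\phi(a_i)^-\setminus\bigcup_{j\le m}\phi(b_j)^+=\emptyset$ then $\bigcap_{i\le n}a_i\setminus\bigcup_{j\le m}b_j=\emptyset$. (Empty intersections are $X$, respectively $K$.) A zero-dimensional compact space $L$ is a Boolean image of a compact space $K$ if there is a family $\mathcal{G}$ of clopen subsets of $L$ (regarded as subsets of $X=L$) which separates the points of $L$ (for all $x\neq y$ in $L$ there is $a\in\mathcal{G}$ with $|a\cap\{x,y\}|=1$)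 and which is isomorphic to a family of pseudoclopens of $K$. *)

(* Defs.v *)
From HB Require Import structures.
From mathcomp Require Import all_boot all_order all_algebra.
From mathcomp Require Import all_classical all_reals all_analysis wochoice.

Set Implicit Arguments.
Unset Strict Implicit.
Unset Printing Implicit Defensive.

Import Order.TTheory GRing.Theory Num.Theory.
Local Open Scope classical_set_scope.
Local Open Scope ring_scope.

Definition compact_space (K : topologicalType) : Prop :=
  [/\ compact [set: K], hausdorff_space K & [set: K] !=set0].

(* The library's [zero_dimensional] only asks clopen sets to separate points. *)
Definition has_clopen_base (K : topologicalType) : Prop :=
  exists2 B : set (set K), B `<=` clopen & basis B.

(* For D included in S, the closure of D in the subspace S is
   [S `&` closure D]. *)
Definition separable_subspace (K : topologicalType) (S : set K) : Prop :=
  exists D : set K, [/\ countable D, D `<=` S & S `<=` closure D].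

Definition separably_connected (K : topologicalType) : Prop :=
  forall x y : K, exists S : set K,
    [/\ S x, S y, connected S & separable_subspace S].

(* The pair (a^-, a^+) is represented by [a : set K * set K],
   with a^- = a.1 and a^+ = a.2. *)
Definition pseudoclopen (K : topologicalType) : set (set K * set K) :=
  [set a | [/\ closed a.1, open a.2 & a.1 `<=` a.2]].

(* [phi] is total on [set X] but only its values on [G] matter. *)
Definition isomorphism (X : Type) (K : topologicalType) (G : set (set X))
    (F : set (set K * set K)) (phi : set X -> set K * set K) : Prop :=
  [/\ F `<=` @pseudoclopen K, set_bij G F phi &
      forall a b : seq (set X), uniq (a ++ b) -> [set` a ++ b] `<=` G ->
      ((\bigcap_(c in [set` a]) c) `\` (\bigcup_(c in [set` b]) c) = set0 ->
        (\bigcap_(c in [set` a]) (phi c).2) `\`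
          (\bigcup_(c in [set` b]) (phi c).1) = set0)
      /\
      ((\bigcap_(c in [set` a]) (phi c).1) `\`
          (\bigcup_(c in [set` b]) (phi c).2) = set0 ->
        (\bigcap_(c in [set` a]) c) `\` (\bigcup_(c in [set` b]) c) = set0)].

Definition isomorphic (X : Type) (K : topologicalType) (G : set (set X))
    (F : set (set K * set K)) : Prop :=
  exists phi, isomorphism G F phi.

(* |a `&` [set x; y]| = 1 is expressed as "is a singleton". *)
Definition separates_points (X : Type) (G : set (set X)) : Prop :=
  forall x y : X, x <> y ->
    exists2 a, G a & exists z, a `&` [set x; y] = [set z].

Definition boolean_image (L K : topologicalType) : Prop :=
  exists G : set (set L),
    [/\ G `<=` clopen, separates_points G &
        exists2 F : set (set K * set K),
          F `<=` @pseudoclopen K & isomorphic G F].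

Definition boolean_image_of_connected (L : topologicalType) : Prop :=
  exists K : topologicalType,
    [/\ compact_space K, connected [set: K] & boolean_image L K].

Definition boolean_image_of_separably_connected (L : topologicalType) : Prop :=
  exists K : topologicalType,
    [/\ compact_space K, separably_connected K & boolean_image L K].

(* [R *l bool] carries the lexicographic order. The isolated endpoints (0, 0)
   and (1, 1) are kept when [ends] is true and removed when it is false. *)
Definition split_interval_pred (R : realType) (ends : bool) :
    pred (R *l bool)%type :=
  fun p => (0 <= p.1 <= 1) &&
    (ends || (p != (0, false)) && (p != (1, true))).

Definition split_interval_points (R : realType) (ends : bool) : Type :=
  {p : (R *l bool)%type | split_interval_pred ends p}.

HB.instance Definition _ (R : realType) (ends : bool) :=
  SubChoice.on (split_interval_points R ends).
HB.instance Definition _ (R : realType) (ends : bool) :=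
  [SubChoice_isSubOrder of split_interval_points R ends by <:
     with Order.default_display].

Definition split_interval (R : realType) (ends : bool) :
    orderTopologicalType Order.default_display :=
  order_topology (split_interval_points R ends).

(* W is order isomorphic to [0, omega_1]: it is well ordered, has a greatest
   element t, and `]-oo, t[ is uncountable while all its proper initial
   segments are countable, i.e., `]-oo, t[ has order type omega_1. *)
Definition is_omega1_interval d (W : orderType d) : Prop :=
  well_order (<=%O : rel W) /\
  exists t : W, [/\ forall x : W, (x <= t)%O,
    ~ countable [set` `]-oo, t[%O] &
    forall x : W, (x < t)%O -> countable [set` `]-oo, x[%O]].

(* A model of [0, omega_1]: given a well-ordering R of an uncountable type, the
   points with countably many predecessors form a copy of omega_1, and [None]
   is added on top. *)
Lemma omega1_interval_exists :
  exists (d : Order.disp_t) (W : orderTopologicalType d), is_omega1_interval W.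
Proof.
have unc : ~ countable [set: set nat].
  move=> /countable_injP[f finj].
  pose D := [set n | exists2 A, f A = n & ~ A n].
  have DP : D (f D) <-> ~ D (f D).
    split=> [[A fA nA]|nD]; last by exists D.
    by have AD : A = D by [apply: finj; rewrite ?inE]; rewrite AD in nA.
  have nD : ~ D (f D) by move=> h; have /DP := h; apply.
  by apply: (nD); apply/DP.
have [R Rwo] := well_ordering_principle (set nat).
have Rch : wo_chain R predT by move=> A _; exact: Rwo.
have Rrefl x : R x x by exact: (wo_chain_reflexive Rch).
have Ranti : antisymmetric R.
  by move=> x y; exact: (wo_chain_antisymmetric Rch).
have Rtot : total R by move=> x y; exact: (wo_chainW Rch).
have Rtr : transitive R.
  move=> y x z xy yz.
  have [|m [[]]] := Rwo (pred3 x y z); first by exists x; rewrite inE eqxx.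
  rewrite !inE => /or3P[]/eqP-> lb _.
  - by apply: lb; rewrite !inE eqxx !orbT.
  - have -> : x = y by apply: Ranti; rewrite xy lb// !inE eqxx.
    by [].
  - have yzE : y = z by apply: Ranti; rewrite yz lb// !inE eqxx ?orbT.
    by rewrite -yzE.
pose seg x : set (set nat) := [set y | R y x /\ y <> x].
have inj_countable (T U : Type) (f : T -> U) (B : set T) (C : set U) :
    {in B &, injective f} -> (forall x, B x -> C (f x)) ->
    countable C -> countable B.
  move=> finj fBC /countable_injP[g ginj]; apply/countable_injP.
  exists (g \o f) => x y /[!inE] Bx By /= gxy; apply: finj; rewrite ?inE//.
  by apply: ginj => //; rewrite inE; exact: fBC.
pose A := {x : set nat | `[< countable (seg x) >]}.
pose le (u v : option A) := match u, v with
  | _, None => true | None, Some _ => false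
  | Some x, Some y => R (val x) (val y) end.
have le_refl : reflexive le by case=> /=.
have le_anti : antisymmetric le.
  by case=> [x|] [y|]//= /Ranti /val_inj ->.
have le_tr : transitive le by case=> [y|] [x|] [z|]//=; exact: Rtr.
have le_tot : total le by case=> [x|] [y|]//=; exact: Rtot.
pose pW := Order.Le_isPOrder.Build Order.default_display (option A)
  le_refl le_anti le_tr.
pose P : porderType Order.default_display := HB.pack (option A) pW.
pose tW := Order.POrder_isTotal.Build _ P le_tot.
pose W : orderType Order.default_display := HB.pack (option A) pW tW.
exists Order.default_display, (order_topology W).
have leE (x y : W) : (x <= y)%O = le x y by [].
have itvP (u v : W) : [set` `]-oo, v[%O] u -> u <> v /\ le u v.
  by rewrite /mkset in_itv /= -/(u < v)%O lt_neqAle => /andP[/eqP].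
have wo : well_order (<=%O : rel W).
  apply: antisymmetric_well_order; first by move=> x y; exact: le_anti.
  move=> B [b0 Bb0].
  have [[a Ba]|noB] := pselect (exists a : A, (Some a : W) \in B); last first.
    exists None; split.
      by case: b0 Bb0 => // a Ba; case: noB; exists a.
    by case=> // a Ba; case: noB; exists a.
  have [|m [[mB mlb] _]] := Rwo [pred x |
      `[< exists2 a : A, val a = x & (Some a : W) \in B >]].
    by exists (val a); apply/asboolP; exists a.
  move: mB => /asboolP[c cm Bc].
  exists (Some c); split=> // -[e|]// Be; rewrite leE /= cm; apply: mlb.
  by apply/asboolP; exists e.
split; first exact: wo.
exists (None : W); split.
- by case.
- move=> cW.
  have insubE x (cx : countable (seg x)) :
      insub x = Some (exist _ x (asboolT cx)) :> option A.
    by rewrite insubT; [exact/asboolP|move=> ?; congr Some; exact: val_inj].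
  have cA : countable [set x | countable (seg x)].
    apply: (@inj_countable _ W insub _ _ _ _ cW) => [x y /[!inE] cx cy|x cx].
      by rewrite (insubE _ cx) (insubE _ cy) => -[].
    by rewrite (insubE _ cx) /=.
  have [allA|] := pselect (forall x, countable (seg x)).
    by apply: unc;
      apply: (inj_countable _ _ id _ _ _ _ cA) => x //= _; exact: allA.
  move=> /existsNP[x0 nx0].
  have [|m [[mB mlb] _]] := Rwo [pred x | ~~ `[< countable (seg x) >]].
    by exists x0; apply/asboolPn.
  move: mB => /asboolPn; apply.
  apply: (inj_countable _ _ id _ _ _ _ cA) => // y [ym ynm] /=.
  apply: contrapT => ncy; apply: ynm; apply: Ranti; rewrite ym mlb//.
  exact/asboolPn.
- case=> [a|]; last by rewrite ltxx.
  move=> _; have /asboolP ca := valP a.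
  apply: (@inj_countable W _ (oapp val set0) _ _ _ _ ca) => -[x|].
  - move=> [y|]; rewrite !inE; last by move=> _ /itvP[].
    by move=> _ _ /= /val_inj ->.
  - by move=> y; rewrite !inE => /itvP[].
  - move=> /itvP[xa Rxa]; split=> // vxa.
    by apply: xa; congr Some; exact: val_inj.
  - by move=> /itvP[].
Qed.

(* Main.v *)
(* Both spaces are complete linear orders in which any x < y are separated by a
   jump u < v (v covers u). Filling every jump with a copy of ]0, 1[ yields a
   compact connected ordered space K, and the initial segment ]-oo, u] of the
   jump (u, v) corresponds to the pseudoclopen (]-oo, u], ]-oo, v[) of K.

   Conversely, let phi be an isomorphism from a separating family G of clopen
   sets onto pseudoclopens of a separably connected K, and call
   phi(a)^+ \ phi(a)^- the gap of a. The sets a in G whose gap contains a given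
   point of K form an independent family. A clopen set of a compact linear order
   changes value finitely often along the order, and n independent sets changing
   value at most k times satisfy 2^n <= n k + 1, since 2^n points realizing all
   patterns, listed in increasing order, alternate at every step.
   Hence each point of K lies in countably many gaps. If a separates x from y,
   its gap meets every connected set joining points over x and over y, hence
   meets any countable dense subset of it; so only countably many a in G separate
   x from y. In the split interval this makes the set of a in G separating some
   jump countable (compare the values at rational points), whereas each a
   separates finitely many of the uncountably many jumps. In [0, omega_1], every
   a is eventually constant below omega_1, so there are
   alpha_0 < alpha_1 < ... < omega_1 such that every a in G separating alpha_n
   from omega_1 is constant from alpha_(n+1) on; no a can then separate
   sup alpha_n from omega_1. *)
From HB Require Import structures.
Require Import Defs.
From mathcomp Require Import all_boot all_order all_algebra.
From mathcomp Require Import finmap all_classical all_reals all_analysis.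
From mathcomp Require Import wochoice zify Rstruct.

Set Implicit Arguments.
Unset Strict Implicit.
Unset Printing Implicit Defensive.

Import Order.TTheory GRing.Theory Num.Theory.
Local Open Scope order_scope.
Local Open Scope classical_set_scope.

(** * Compactness, clopen bases and connectedness of ordered spaces *)

(** Taking [A] empty or full shows that such an order has a least and a greatest element. *)
Definition sup_complete d (L : porderType d) : Prop :=
  forall A : set L, exists s : L, forall y : L, ubound A y <-> s <= y.

Definition jump d (L : porderType d) (u v : L) : Prop :=
  u < v /\ forall z : L, z <= u \/ v <= z.

Definition jump_dense d (L : porderType d) : Prop :=
  forall x y : L, x < y -> exists u v : L, [/\ jump u v, x <= u & v <= y].

Section OrderTopology.
Context d (L : orderTopologicalType d).
Implicit Types (x y z u v : L) (A : set L).

Lemma nbhs_rays x A : nbhs x A -> exists P Q : set L,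
  [/\ P = setT \/ (exists2 y, y < x & P = [set z | y < z]),
      Q = setT \/ (exists2 y, x < y & Q = [set z | z < y])
    & P `&` Q `<=` A].
Proof.
rewrite itv_nbhsE => -[[l r] /= [oi xi] iA].
have [lE rE] : (l = -oo \/ exists y, l = BRight y)%O /\
               (r = +oo \/ exists y, r = BLeft y)%O.
  by move: oi xi iA; case: l => [[] l|[]]; case: r => [[] r|[]] //=;
    rewrite /itv_open_ends //= => *; split; (by left) || (right; eexists).
exists (if l is BSide _ y then [set z | y < z] else setT).
exists (if r is BSide _ y then [set z | z < y] else setT).
move: xi iA; rewrite itv_boundlr => /andP[]; case: lE => [->|[l0 ->]] /=;
  case: rE => [->|[r0 ->]] /=; rewrite ?bnd_simp => xl xr iA; split;
  try (by left); try (by right; exists l0); try (by right; exists r0).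
all: move=> z [zl zr]; apply: iA; rewrite /= in_itv /= ?andbT //.
by apply/andP.
Qed.

Lemma nbhs_left x w A : nbhs x A -> w < x ->
  exists2 y, y < x & [set z | y < z <= x] `<=` A.
Proof.
move=> /nbhs_rays[P [Q [PE QE PQA]]] wx.
have Qz z : z <= x -> Q z.
  by move=> zx; case: QE => [->//|[y xy ->]]; exact: le_lt_trans xy.
case: PE => [PE|[y yx PE]].
  by exists w => // z /= /andP[_ zx]; apply: PQA; split; [rewrite PE|exact: Qz].
exists y => // z /= /andP[yz zx].
by apply: PQA; split; [rewrite PE|exact: Qz].
Qed.

Lemma nbhs_right x w A : nbhs x A -> x < w ->
  exists2 y, x < y & [set z | x <= z < y] `<=` A.
Proof.
move=> /nbhs_rays[P [Q [PE QE PQA]]] wx.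
have Pz z : x <= z -> P z.
  by move=> zx; case: PE => [->//|[y xy ->]]; exact: lt_le_trans xy _.
case: QE => [QE|[y yx QE]].
  by exists w => // z /= /andP[zx _]; apply: PQA; split; [exact: Pz|rewrite QE].
exists y => // z /= /andP[yz zx].
by apply: PQA; split; [exact: Pz|rewrite QE].
Qed.

(** An ultrafilter converges to the supremum of the [x] whose closed final segment belongs to it. *)
Lemma sup_complete_compact : sup_complete L -> compact [set: L].
Proof.
move=> supL; rewrite compact_ultra => F FU _.
have [s sP] := supL [set x | F [set z | x <= z]].
exists s; split=> // A /nbhs_rays[P [Q [PE QE PQA]]].
apply: (filterS PQA); apply: filterI.
  case: PE => [->|[y ys ->]]; first exact: filterT.
  have /existsNP[x /not_implyP[Fx xy]] : ~ ubound [set x | F [set z | x <= z]] y.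
    by move=> /sP; rewrite leNgt ys.
  apply: filterS Fx => z /=; apply: lt_le_trans.
  by rewrite ltNge; exact/negP.
case: QE => [->|[y sy ->]]; first exact: filterT.
have [Fy|] := in_ultra_setVsetC [set z | y <= z] FU.
  have /sP/(_ y Fy) : s <= s by [].
  by rewrite leNgt sy.
by apply: filterS => z /= /negP; rewrite -ltNge.
Qed.

(** At a jump, the closed ray from [v] is also the open ray above [u]. *)
Lemma jump_clopen u v : jump u v -> clopen [set z | v <= z].
Proof.
move=> [uv J]; have E : [set z | v <= z] = [set z | u < z].
  apply/seteqP; split=> z /= h; first exact: lt_le_trans uv h.
  by case: (J z) => // zu; move: (lt_le_trans h zu); rewrite ltxx.
split; last by have := @rray_closed _ L v; rewrite set_itvE.
by rewrite E; have := @rray_open _ L u; rewrite set_itvE.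
Qed.

Lemma jump_dense_clopen_base : jump_dense L -> has_clopen_base L.
Proof.
move=> JL; exists clopen => //; split=> [A []//|x A /nbhs_rays[P [Q [PE QE PQA]]]].
have [B [cB Bx BP]] : exists B, [/\ clopen B, B x & B `<=` P].
  case: PE => [->|[y yx ->]]; first by exists setT; split; [exact: clopenT| |].
  have [u [v [J yu vx]]] := JL _ _ yx.
  exists [set z | v <= z]; split=> //; first exact: jump_clopen J.
  by move=> z /=; apply: lt_le_trans; apply: le_lt_trans yu _; case: J.
have [C [cC Cx CQ]] : exists C, [/\ clopen C, C x & C `<=` Q].
  case: QE => [->|[y xy ->]]; first by exists setT; split; [exact: clopenT| |].
  have [u [v [J xu vy]]] := JL _ _ xy.
  exists (~` [set z | v <= z]); split.
  - exact: (@clopenC _ _ set0 (jump_clopen J)).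
  - by move=> /=; apply/negP; rewrite -ltNge; apply: le_lt_trans xu _; case: J.
  - by move=> z /= /negP; rewrite -ltNge => zv; exact: lt_le_trans zv vy.
exists (B `&` C); first by split; [exact: clopenI|split].
by apply: subset_trans PQA; exact: setISS.
Qed.

(** Let [s] be the supremum of the [x] such that all points from [a] to [x] lie in [B]. If [s] is in
    [B], density continues the stretch beyond [s]; if not, points of the stretch just below [s] lie
    outside [B]. *)
Lemma sup_complete_connected : sup_complete L ->
  (forall x y, x < y -> exists z, x < z < y) -> connected [set: L].
Proof.
move=> supL dL.
suff key (B : set L) (a b : L) : open B -> open (~` B) -> B a -> ~ B b -> a < b -> False.
  move=> B [a Ba] [U oU BU] [C cC BC].
  rewrite setTI in BU; rewrite setTI in BC; subst U.
  have oB : open (~` B) by rewrite BC openC.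
  apply/seteqP; split=> // b _; apply: contrapT => nBb.
  have /lt_total/orP[ab|ba] : a != b by apply/eqP => ab; rewrite ab in Ba.
    exact: (key B a b).
  by apply: (key (~` B) b a) => //; rewrite ?setCK //; exact: (@^~ Ba).
move=> oB oC Ba nBb ab.
pose A := [set x | a <= x /\ forall z, a <= z <= x -> B z].
have [s sP] := supL A.
have Aa : A a by split=> // z /le_anti <-.
have As : ubound A s by apply/sP.
have below w : w < s -> exists2 x, A x & w < x.
  move=> ws; have /existsNP[x /not_implyP[Ax xw]] : ~ ubound A w.
    by move=> /sP; rewrite leNgt ws.
  by exists x => //; rewrite ltNge; exact/negP.
have sb : s <= b.
  apply/sP => x [ax xB]; rewrite leNgt; apply/negP => bx.
  by apply/nBb/xB; rewrite !ltW.
have [Bs|nBs] := pselect (B s).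
  have s_lt_b : s < b.
    by rewrite lt_neqAle sb andbT; apply/eqP => sE; rewrite sE in Bs.
  have := oB; rewrite openE => /(_ _ Bs) /nbhs_right/(_ s_lt_b)[y sy yB].
  have [z /andP[sz zy]] := dL _ _ sy.
  have /As : A z.
    split; first exact: le_trans (As _ Aa) (ltW sz).
    move=> w /andP[aw wz]; have [ws|sw] := ltP w s.
      by have [x [_ xB] /ltW wx] := below _ ws; apply: xB; rewrite aw.
    by apply: yB; rewrite /= sw (le_lt_trans wz).
  by rewrite leNgt sz.
have a_lt_s : a < s.
  by rewrite lt_neqAle As// andbT; apply/eqP => sE; rewrite sE in Ba.
have := oC; rewrite openE => /(_ _ nBs) /nbhs_left/(_ a_lt_s)[y ys yB].
have [x [ax xB] yx] := below _ ys.
by apply: (yB x); rewrite /= ?yx ?As//; apply: xB; rewrite ?ax lexx.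
Qed.

End OrderTopology.

(** * Filling the jumps of a linear order with real intervals *)

(* The point x of L becomes (x, 1), and (x, r) with r < 1 lies in the gap between
   x and its predecessor. *)
Definition fill_pred d (L : orderType d) (R : realType) : pred (L *l R)%type :=
  fun p => (0 < p.2 <= 1)%R && ((p.2 == 1%R) || `[< exists u, jump u p.1 >]).

Definition fill d (L : orderType d) (R : realType) : Type :=
  {p : (L *l R)%type | fill_pred p}.

HB.instance Definition _ d (L : orderType d) (R : realType) :=
  SubChoice.on (fill L R).
HB.instance Definition _ d (L : orderType d) (R : realType) :=
  [SubChoice_isSubOrder of fill L R by <: with Order.default_display].

Section Fill.
Context d (L : orderType d) (R : realType).
Implicit Types (k l : fill L R) (x y : L).

Lemma fill_leE k l : (k <= l) =
  ((val k).1 < (val l).1) || ((val k).1 == (val l).1) && ((val k).2 <= (val l).2)%R.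
Proof.
rewrite leEsub /= leEprodlexi; case: ltgtP => //=.
Qed.

Lemma fill_ltE k l : (k < l) =
  ((val k).1 < (val l).1) || ((val k).1 == (val l).1) && ((val k).2 < (val l).2)%R.
Proof.
rewrite (ltNge k l) (fill_leE l k) (ltNge (val k).2).
by case: (ltgtP (val k).1 (val l).1).
Qed.

Lemma fill_val2_bounds k : (0 < (val k).2 <= 1)%R.
Proof. by case: k => -[x r] /= /andP[]. Qed.

Lemma fill_pred1 x : fill_pred ((x, 1%R) : (L *l R)%type).
Proof. by rewrite /fill_pred /= ltr01 lexx eqxx. Qed.

Definition fill1 x : fill L R := exist [eta @fill_pred d L R] _ (fill_pred1 x).

Lemma fill_jump (u v : L) (r : R) : jump u v -> (0 < r <= 1)%R ->
  exists k : fill L R, val k = (v, r).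
Proof.
move=> uv r01.
have p : fill_pred ((v, r) : (L *l R)%type).
  rewrite /fill_pred /= r01 /=; apply/orP; right; apply/asboolP.
  by exists u.
by exists (exist [eta @fill_pred d L R] _ p).
Qed.

Lemma fill_lt1 k : ((val k).2 < 1)%R -> exists u, jump u (val k).1.
Proof.
case: k => -[x r] /= /andP[_ /= /orP[/eqP ->|/asboolP//]].
by rewrite ltxx.
Qed.

Lemma fill_dense : jump_dense L -> forall k l, k < l -> exists m, k < m < l.
Proof.
move=> JL k l; rewrite fill_ltE => /orP[kl|/andP[/eqP kl1 kl2]]; last first.
  have k1 : ((val k).2 < 1)%R.
    by apply: lt_le_trans kl2 _; case/andP: (fill_val2_bounds l).
  have [u J] := fill_lt1 k1.
  have [km ml] := midf_lt kl2.
  have [|m mE] := fill_jump (r := (((val k).2 + (val l).2) / 2%:R)%R) J.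
    rewrite (lt_trans _ km) /=; last by case/andP: (fill_val2_bounds k).
    by apply: le_trans (ltW ml) _; case/andP: (fill_val2_bounds l).
  by exists m; rewrite !fill_ltE mE /= kl1 eqxx ltxx /= km ml.
have [u [v [J ku vl]]] := JL _ _ kl.
have /andP[l0 l1] := fill_val2_bounds l.
(* Halving the second coordinate puts [m] below [l] even when [v] is the first coordinate of [l]. *)
have [|m mE] := fill_jump (r := ((val l).2 / 2%:R)%R) J.
  rewrite divr_gt0 //= ler_pdivrMr // (le_trans l1) // mul1r.
  by rewrite (ler_nat _ 1 2).
exists m; rewrite !fill_ltE mE /=; apply/andP; split.
  by rewrite (le_lt_trans ku) //; case: J.
have l2 : ((val l).2 / 2%:R < (val l).2)%R.
  by rewrite ltr_pdivrMr // ltr_pMr // (ltr_nat _ 1 2).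
by move: vl; rewrite le_eqVlt l2 andbT orbC.
Qed.

Lemma fill_sup_complete : sup_complete L -> sup_complete (fill L R).
Proof.
move=> supL A.
have [s sP] := supL [set (val k).1 | k in A].
have As k : A k -> (val k).1 <= s.
  by move=> Ak; have /sP : s <= s by []; apply; exists k.
have s_le (l : fill L R) : ubound A l -> s <= (val l).1.
  move=> Al; apply/sP => _ [k /Al kl <-].
  by move: kl; rewrite fill_leE => /orP[/ltW//|/andP[/eqP->]].
(* If [s] is attained, the supremum lies over [s], at the supremum of the second coordinates found
   there; otherwise it is [fill1 s]. *)
have [[k0 Ak0 k0s]|nA] := pselect (exists2 k, A k & (val k).1 = s).
  pose B := [set (val k).2 | k in A `&` [set k | (val k).1 = s]].
  have Bk0 : B (val k0).2 by exists k0.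
  have supB : has_sup B.
    split; first by exists (val k0).2.
    by exists 1%R => _ [k _ <-]; case/andP: (fill_val2_bounds k).
  have k0B : ((val k0).2 <= sup B)%R by exact: sup_ubound supB.2 _ Bk0.
  have p : fill_pred ((s, sup B) : (L *l R)%type).
    apply/andP; split=> /=.
      rewrite (lt_le_trans _ k0B); last by case/andP: (fill_val2_bounds k0).
      apply: sup_le_ub; first by exists (val k0).2.
      by move=> _ [k _ <-]; case/andP: (fill_val2_bounds k).
    have [//|nB1] := eqVneq (sup B) 1%R; apply/asboolP; rewrite -k0s.
    apply: fill_lt1; apply: le_lt_trans k0B _.
    rewrite lt_neqAle nB1; apply: sup_le_ub; first by exists (val k0).2.
    by move=> _ [k _ <-]; case/andP: (fill_val2_bounds k).
  exists (exist [eta @fill_pred d L R] _ p) => l; split=> [Al|ml k Ak].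
    have := s_le _ Al; rewrite fill_leE /= le_eqVlt => /orP[/eqP sE|->//].
    apply/orP; right; rewrite sE eqxx /=.
    apply: sup_le_ub; first by exists (val k0).2.
    move=> _ [k [/Al kl /= ks] <-]; move: kl.
    by rewrite fill_leE ks sE ltxx eqxx.
  apply: le_trans ml; rewrite fill_leE /=.
  have := As _ Ak; rewrite le_eqVlt => /orP[/eqP ks|->//].
  rewrite ks eqxx ltxx /=; apply: sup_ubound; first exact: supB.2.
  by exists k.
exists (fill1 s) => l; split=> [Al|ml k Ak].
  have := s_le _ Al; rewrite fill_leE /= le_eqVlt => /orP[/eqP sE|->//].
  (* An upper bound over [s] but below [fill1 s] would lie inside a filled jump from some [u] to
     [s]; as [s] is not attained, [u] would already bound all first coordinates. *)
  apply/orP; right; rewrite sE eqxx /= leNgt; apply/negP => /fill_lt1[u []].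
  rewrite -sE => us J; have : s <= u.
    apply/sP => _ [k Ak <-]; case: (J (val k).1) => // sk.
    by case: nA; exists k => //; apply/le_anti; rewrite As.
  by rewrite leNgt us.
apply: le_trans ml; rewrite fill_leE /=.
have := As _ Ak; rewrite le_eqVlt => /orP[/eqP ks|->//].
by rewrite ks eqxx /=; case/andP: (fill_val2_bounds k) => _ ->; rewrite orbT.
Qed.

End Fill.

(** * Complete jump-dense orders as images of connected spaces *)

Lemma sup_complete_nonempty d (L : porderType d) :
  sup_complete L -> [set: L] !=set0.
Proof. by move=> /(_ set0)[s _]; exists s. Qed.

Lemma sup_complete_compact_space d (L : orderTopologicalType d) :
  sup_complete L -> compact_space L.
Proof.
move=> supL; split; first exact: sup_complete_compact.
  exact: order_hausdorff.
exact: sup_complete_nonempty.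
Qed.

Section ConnectedImage.
Context d (L : orderTopologicalType d) (R : realType).
Hypotheses (supL : sup_complete L) (jumpL : jump_dense L).

Let K := order_topology (fill L R).
Let G : set (set L) :=
  [set A | exists u v, jump u v /\ A = [set z | z <= u]].
(** For an initial segment ending at a jump from [u] to [v], the pair consists of the rays up to
    [fill1 u] included and up to [fill1 v] excluded; this form depends on the set alone, with no
    choice of a jump. *)
Let phi (A : set L) : set K * set K :=
  ([set k : K | A (val k).1],
   [set k : K | forall z, ~ A z -> k < (fill1 R z : K)]).

(** [fill1 R z] is the last point of [K] with first coordinate [z]. *)
Let fill1_le (k : K) (z : L) : (k <= (fill1 R z : K)) = ((val k).1 <= z).
Proof.
rewrite (fill_leE (k : fill L R) (fill1 R z)) /= [RHS]le_eqVlt orbC.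
by case/andP: (fill_val2_bounds k) => _ ->; rewrite andbT.
Qed.

Let phi2E u v : jump u v ->
  (phi [set z | z <= u]).2 = [set k : K | k < (fill1 R v : K)].
Proof.
move=> [uv J]; apply/seteqP; split=> k /= kv.
  by apply: kv; apply/negP; rewrite -ltNge.
move=> z /negP zu; have vz : v <= z by case: (J z) => // h; rewrite h in zu.
by apply: (lt_le_trans kv); rewrite (fill1_le (fill1 R v : K) z).
Qed.

Lemma jump_dense_connected_image : boolean_image_of_connected L.
Proof.
exists K; split.
- exact/sup_complete_compact_space/fill_sup_complete.
- apply: sup_complete_connected; first exact: fill_sup_complete.
  exact: fill_dense.
have Gps : phi @` G `<=` @pseudoclopen K.
  move=> _ [_ [u [v [uv ->]]] <-]; split.
  - have -> : (phi [set z | z <= u]).1 = `]-oo, (fill1 R u : K)].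
      by rewrite set_itvE; apply/seteqP; split=> k /=; rewrite fill1_le.
    exact: lray_closed.
  - rewrite (phi2E uv); have := @lray_open _ K (fill1 R v : K).
    by rewrite set_itvE.
  - rewrite (phi2E uv) => k /= ku; rewrite ltNge; apply/negP => vk.
    have : (fill1 R v : K) <= (fill1 R u : K).
      by apply: le_trans vk _; rewrite fill1_le.
    by rewrite (fill1_le (fill1 R v : K) u) /= leNgt; case: uv => ->.
exists G; split.
- move=> _ [u [v [uv ->]]].
  have -> : [set z | z <= u] = ~` [set z | v <= z].
    apply/seteqP; split=> z /=.
      by case: uv => uv _ zu; apply/negP; rewrite -ltNge (le_lt_trans zu).
    by case: uv => _ /(_ z)[].
  exact: (@clopenC _ _ set0 (jump_clopen uv)).
- suff sep x y : x < y -> exists2 a, G a & a `&` [set x; y] = [set x].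
    move=> x y /eqP /lt_total /orP[/sep[a Ga axy]|/sep[a Ga axy]].
      by exists a => //; exists x.
    by exists a => //; exists y; rewrite setUC.
  move=> xy; have [u [v [J xu vy]]] := jumpL xy.
  exists [set z | z <= u]; first by exists u, v.
  apply/seteqP; split=> z /=.
    move=> [zu [->//|zy]]; case: J => uv _; rewrite zy in zu.
    by move: (lt_le_trans uv (le_trans vy zu)); rewrite ltxx.
  by move=> ->; split=> //; left.
exists (phi @` G) => //; exists phi; split=> //.
  split; first by move=> A GA; exists A.
    move=> A B _ _ /(congr1 fst) /= AB; apply/seteqP; split=> z Az.
      have : [set k : K | A (val k).1] (fill1 R z) by [].
      by rewrite AB.
    have : [set k : K | B (val k).1] (fill1 R z) by [].
    by rewrite -AB.
  by [].
(* Both clauses go by contraposition. For the second, a point [x] of [L] realizing the pattern lifts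
   to [fill1 R x]. *)
move=> a b; rewrite cat_uniq => /and3P[_ /hasPn ab _] abG; split; last first.
  apply: contra_eq => /set0P[x [xa xb]]; apply/set0P; exists (fill1 R x).
  split=> [c ca|[c cb]] /=; first exact: xa.
  have [cx|ncx] := pselect (c x); first by case: xb; exists c.
  by move=> /(_ _ ncx); rewrite ltxx.
apply: contra_eq => /set0P[k [ka kb]]; apply/set0P.
have [ax|] := pselect (forall c, c \in a -> c (val k).1).
  exists (val k).1; split=> [c|[c cb cx]]; first exact: ax.
  by apply: kb; exists c.
move=> /existsNP[c /not_implyP[ca ncx]].
have [u [v [uv cE]]] : G c by apply: abG; rewrite /= mem_cat ca.
have ux : u < (val k).1.
  by rewrite ltNge; apply/negP; move: ncx; rewrite cE.
have xv : (val k).1 <= v.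
  by have := ka _ ca; rewrite cE (phi2E uv) /= => /ltW; rewrite fill1_le.
(* Here [k] lies in the gap of [c]. The point [u] lies in every member of [a], and a member of [b]
   containing it would have to be [c], against distinctness. *)
exists u; split=> [c' c'a|[c' c'b c'u]].
  have [u' [v' [uv' c'E]]] : G c' by apply: abG; rewrite /= mem_cat c'a.
  have := ka _ c'a; rewrite c'E (phi2E uv') /= => /ltW; rewrite fill1_le => xv'.
  case: uv' => _ /(_ u)[//|v'u].
  by have := lt_le_trans ux (le_trans xv' v'u); rewrite ltxx.
have [u' [v' [uv' c'E]]] : G c' by apply: abG; rewrite /= mem_cat c'b orbT.
have u'x : u' < (val k).1.
  rewrite ltNge; apply/negP => xu'; apply: kb; exists c' => //=.
  by rewrite c'E.
have u'u : u' = u.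
  apply/le_anti; move: c'u; rewrite c'E /= => ->; rewrite andbT.
  case: uv => _ /(_ u')[//|vu'].
  by have := lt_le_trans u'x (le_trans xv vu'); rewrite ltxx.
by have := ab _ c'b; rewrite c'E u'u -cE ca.
Qed.

End ConnectedImage.

(** * Alternations of clopen sets along a linear order *)

Lemma nbhs_convex d (L : orderTopologicalType d) (x : L) (A : set L) :
  nbhs x A -> exists V : set L, [/\ open V, V x,
    (forall u v w, V u -> V w -> u <= v <= w -> V v) & V `<=` A].
Proof.
move=> /nbhs_rays[P [Q [PE QE PQA]]]; exists (P `&` Q); split=> //.
- apply: openI.
    case: PE => [->|[y _ ->]]; first exact: openT.
    by have := @rray_open _ L y; rewrite set_itvE.
  case: QE => [->|[y _ ->]]; first exact: openT.
  by have := @lray_open _ L y; rewrite set_itvE.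
- split; first by case: PE => [->|[y xy ->]].
  by case: QE => [->|[y xy ->]].
- move=> u v w [Pu _] [_ Qw] /andP[uv vw]; split.
    by case: PE Pu => [->//|[y _ ->]] /= /lt_le_trans; apply.
  by case: QE Qw => [->//|[y _ ->]] /=; exact: le_lt_trans.
Qed.

(** Changes of value are counted along finite weakly increasing sequences, of which only [p 0] to
    [p m] matter; this avoids decomposing [a] into intervals. *)
Definition alternations_le d (L : orderType d) (k : nat) (a : set L) : Prop :=
  forall (m : nat) (p : nat -> L), (forall i j, (i <= j <= m)%N -> p i <= p j) ->
  (#|[set i : 'I_m | (p i \in a) != (p i.+1 \in a)]%SET| <= k)%N.

(** Two places where [a] changes value get distinct colours, since [a] is constant between points of
    equal colour. *)
Lemma coloring_alternations d (L : orderType d) (a : set L) (s : seq L)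
    (c : L -> L) :
  (forall x, c x \in s) ->
  (forall x y z, c x = c z -> x <= y <= z -> a x <-> a y) ->
  alternations_le (size s) a.
Proof.
move=> cs ca m p homp; set B := [set i | _]%SET.
have cinj : {in B &, injective (fun i : 'I_m => c (p i))}.
  suff lt_neq (i j : 'I_m) : i \in B -> (i < j)%N -> c (p i) <> c (p j).
    move=> i j iB jB cij; apply/val_inj.
    case: (ltngtP i j) => // ij; first by case: (lt_neq i j iB ij).
    by case: (lt_neq j i jB ij).
  rewrite inE => aN ij cij; move/negP: aN; apply; apply/eqP.
  have aE : a (p i) <-> a (p i.+1).
    apply: (ca _ _ _ cij); rewrite !homp//; have := ltn_ord j => /ltnW jm.
      by rewrite ij.
    by rewrite leqnSn (leq_trans ij).
  by apply/idP/idP; rewrite !inE => /aE.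
rewrite cardE -(size_map (fun i : 'I_m => c (p i))).
apply: uniq_leq_size; last by move=> _ /mapP[i _ ->].
rewrite map_inj_in_uniq ?enum_uniq// => i j; rewrite !mem_enum; exact: cinj.
Qed.

Lemma clopen_coloring d (L : orderTopologicalType d) (a : set L) :
  compact [set: L] -> clopen a -> exists (s : seq L) (c : L -> L),
    (forall x, c x \in s) /\
    (forall x y z, c x = c z -> x <= y <= z -> a x <-> a y).
Proof.
(* The cover criterion used below concerns pointed spaces, so the empty order is set aside. *)
have [[x0 _]|L0] := pselect (exists x0 : L, True); last first.
  move=> _ _; exists nil, id; split=> x; by case: L0; exists x.
move=> cL [oa cla].
pose P : ptopologicalType := HB.pack L (isPointed.Build L x0).
(* [c x] is the centre of a member, containing [x], of a finite cover by convex
   open sets on which [a] is constant. *)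
have /choice[U UP] x : exists V : set L, [/\ open V, V x,
    (forall u v w, V u -> V w -> u <= v <= w -> V v) &
    (forall u v, V u -> V v -> a u <-> a v)].
  have [ax|nax] := pselect (a x).
    have [|V [oV Vx cV Va]] := @nbhs_convex _ L x a.
      by move: oa; rewrite openE; exact.
    by exists V; split=> // u v /Va au /Va av.
  have [|V [oV Vx cV Va]] := @nbhs_convex _ L x (~` a).
    by have := closed_openC cla; rewrite openE; exact.
  by exists V; split=> // u v /Va au /Va av.
have : @compact P [set: P] by [].
rewrite compact_cover => /(_ P setT U)[].
- by move=> x _; case: (UP x).
- by move=> x _; exists x => //; case: (UP x).
move=> D _ cov; exists (enum_fset D).
have /choice[c cP] x : exists y, y \in D /\ U y x.
  by have [y] := cov x I; exists y.
exists c; split=> [x|x y z cxz xyz]; first by have [] := cP x.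
have [[_ Ux] [_ Uz]] := (cP x, cP z); rewrite -cxz in Uz.
have [_ _ conv same] := UP (c x).
by apply: same => //; apply: (conv x y z).
Qed.

Lemma independent_alternations d (L : orderType d) (k : nat) (A : seq (set L)) :
  uniq A -> (forall a, a \in A -> alternations_le k a) ->
  (forall f : pred (set L), exists x, forall a, a \in A -> a x <-> f a) ->
  (2 ^ size A <= size A * k + 1)%N.
Proof.
move=> uA altA indA.
(* [X f] lies in exactly those members of [A] whose index is in [f]. *)
have [X XP] := choice (fun f : {set 'I_(size A)} =>
  indA (fun a => [exists i : 'I_(size A), (nth set0 A i == a) && (i \in f)])).
have {}XP f (i : 'I_(size A)) : nth set0 A i (X f) <-> i \in f.
  rewrite (XP f _ (mem_nth _ (ltn_ord i))); split.
    move=> /existsP[j /andP[/eqP ji jf]]; suff <- : j = i by [].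
    by apply/val_inj/eqP; rewrite -(nth_uniq set0 (ltn_ord j) (ltn_ord i) uA) ji.
  by move=> fi; apply/existsP; exists i; rewrite eqxx.
have Xinj : injective X.
  move=> f g fg; apply/setP => i; apply/idP/idP.
    by move=> /XP; rewrite fg => /XP.
  by move=> /XP; rewrite -fg => /XP.
pose s := sort <=%O [seq X f | f <- enum {set 'I_(size A)}].
have ss : size s = (2 ^ size A)%N.
  by rewrite size_sort size_map -cardE -cardsT -powersetT card_powerset cardsT card_ord.
have us : uniq s by rewrite sort_uniq map_inj_uniq// enum_uniq.
pose x0 := X finset.set0; pose p i := nth x0 s i.
pose B (j : 'I_(size A)) :=
  [set i : 'I_(size s).-1 | (p i \in nth set0 A j) != (p i.+1 \in nth set0 A j)]%SET.
have s0 : (0 < size s)%N by rewrite ss expn_gt0.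
have cB j : (#|B j| <= k)%N.
  apply: altA; first by rewrite mem_nth.
  move=> i i' /andP[ii' i'm]; rewrite /p.
  have i's : (i' < size s)%N. rewrite -(prednK s0) ltnS; exact: i'm.
  apply: (sorted_leq_nth le_trans le_refl) => //; first exact: (sort_sorted le_total).
  by rewrite inE (leq_ltn_trans ii').
(* Double counting of the pairs of a step [i] and a set [j] changing value there: each step occurs
   at least once, each set at most [k] times. *)
rewrite -ss -(prednK s0) addn1 ltnS.
rewrite -[X in (X <= _)%N]card_ord -sum1_card.
have -> : (size A * k = \sum_(j < size A) k)%N by rewrite sum_nat_const card_ord.
apply: (@leq_trans (\sum_(j < size A) #|B j|)); last exact: leq_sum.
have -> : (\sum_(j < size A) #|B j| =
    \sum_(i < (size s).-1) \sum_(j < size A) (i \in B j))%N.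
  by rewrite exchange_big /=; apply: eq_bigr => j _; rewrite -sum1_card big_mkcond.
apply: leq_sum => i _.
have is1 : (i.+1 < size s)%N.
  by rewrite -[X in (_ < X)%N](prednK s0) ltnS.
have sX (n : nat) : (n < size s)%N -> exists f, p n = X f.
  move=> ns; have : p n \in s by exact: mem_nth.
  by rewrite mem_sort => /mapP[f _ ->]; exists f.
have [f pf] := sX _ (ltnW is1); have [g pg] := sX _ is1.
(* Consecutive points realize different patterns, so some set alternates. *)
have fg : f != g.
  apply/eqP => fg; have /eqP := etrans pf (esym (etrans pg (congr1 X (esym fg)))).
  by rewrite nth_uniq// ?(ltnW is1)// => /eqP /n_Sn.
have [j jfg] : exists j, (j \in f) != (j \in g).
  apply/existsP; apply: contraR fg => /existsPn fg; apply/eqP/setP => j.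
  by apply/eqP; have := fg j; rewrite negbK.
rewrite (bigD1 j)//= [i \in B j](_ : _ = true)// inE.
have pE h : (X h \in nth set0 A j) = (j \in h).
  by apply/idP/idP; rewrite inE => /XP.
by rewrite pf pg !pE.
Qed.

(** * Gaps of pseudoclopens and countability of separating families *)

(** Finite subfamilies are duplicate-free sequences, the form in which [isomorphism] treats them. *)
Lemma compact_closed_bigcap (T : topologicalType) (I : choiceType)
    (D : set I) (F : I -> set T) :
  compact [set: T] -> [set: T] !=set0 -> (forall i, D i -> closed (F i)) ->
  (forall s : seq I, uniq s -> [set` s] `<=` D ->
     \bigcap_(i in [set` s]) F i !=set0) ->
  \bigcap_(i in D) F i !=set0.
Proof.
move=> cT [x0 _] clF finF.
pose P : ptopologicalType := HB.pack T (isPointed.Build T x0).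
have : @compact P [set: P] by [].
rewrite compact_In0 => /(_ I D F); apply.
  by exists F => // i _; rewrite setTI.
by move=> D' D'D; apply: finF => [|i /D'D /set_mem]; first exact: fset_uniq.
Qed.

(** Otherwise [a.1] and [a.2] have the same trace on [S], a relatively clopen set containing [x] but
    not [y]. *)
Lemma connected_meets_gap (K : topologicalType) (S : set K)
    (a : set K * set K) (x y : K) :
  pseudoclopen a -> connected S -> S x -> S y -> a.1 x -> ~ a.2 y ->
  (S `&` (a.2 `\` a.1)) !=set0.
Proof.
move=> [ca oa a12] cS Sx Sy ax nay; apply: contrapT => /set0P/negP/negPn/eqP E.
have E12 : S `&` a.2 = S `&` a.1.
  apply/seteqP; split=> z [Sz az]; split=> //; last exact: a12.
  apply: contrapT => naz; suff : set0 z by [].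
  by rewrite -E.
have SE : S `&` a.2 = S.
  apply: cS; first by exists x; split=> //; exact: a12.
    by exists a.2.
  by exists a.1.
by apply: nay; have [] : (S `&` a.2) y by rewrite SE.
Qed.

Lemma ltn_expn2_mul k : exists n, (n * k + 1 < 2 ^ n)%N.
Proof.
(* With [n] equal to 4(k+1), 2^n is the square of a number exceeding 2(k+1), hence at least
   (2k+3)^2. *)
exists (2 * k.+1).*2; rewrite -addnn expnD.
have := ltn_expl (2 * k.+1) (isT : (1 < 2)%N).
set e := (2 ^ _)%N => ke; apply: (@leq_trans ((2 * k.+1).+1 * (2 * k.+1).+1)).
  by nia.
exact: leq_mul.
Qed.

Section SeparatingCountable.
Context d (L : orderTopologicalType d) (K : topologicalType).
Context (G : set (set L)) (F : set (set K * set K)).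
Context (phi : set L -> set K * set K).
Hypotheses (cL : compact [set: L]) (cK : compact_space K).
Hypotheses (clG : G `<=` clopen) (isoG : isomorphism G F phi).

Let phiP a : G a -> @pseudoclopen K (phi a).
Proof. by case: isoG => FK [phiF _ _] _ Ga; apply/FK/phiF. Qed.

(** In a gap, [p] is in the open part and outside the closed part, so it realizes every pattern on
    the side of [K]; clause (1) of the isomorphism transfers this to [L]. *)
Lemma gap_independent (p : K) (s : seq (set L)) : uniq s ->
  [set` s] `<=` [set a | G a /\ ((phi a).2 `\` (phi a).1) p] ->
  forall f : pred (set L), exists x, forall a, a \in s -> a x <-> f a.
Proof.
move=> us sG f; have [_ _ /(_ [seq a <- s | f a] [seq a <- s | ~~ f a])] := isoG.
rewrite (perm_uniq (permEl (perm_filterC f s))) => /(_ us)[].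
  by move=> a; rewrite /= (perm_mem (permEl (perm_filterC f s))) => /sG[].
move=> h _; have : (\bigcap_(c in [set` [seq a <- s | f a]]) c `\`
                    \bigcup_(c in [set` [seq a <- s | ~~ f a]]) c) !=set0.
  apply/set0P/eqP => /h E; suff : set0 p by [].
  rewrite -E; split=> [a|[a + ap]]; rewrite /= mem_filter => /andP[_ /sG[_ []]] //.
move=> [x [xa xb]]; exists x => a sa; split=> [ax|fa].
  by apply: contrapT => /negP nfa; apply: xb; exists a => //=; rewrite mem_filter nfa.
by apply: xa; rewrite /= mem_filter fa.
Qed.

Lemma gap_countable (p : K) :
  countable [set a | G a /\ ((phi a).2 `\` (phi a).1) p].
Proof.
set E := [set a | _].
(* Each layer of bounded alternation number is finite: an infinite one would contain [n] independent
   sets with 2^n > nk + 1. *)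
have -> : E = \bigcup_(k in [set: nat]) (E `&` alternations_le k).
  apply/seteqP; split=> [a Ea|a [k _ []]//].
  have [s [c [cs ca]]] := clopen_coloring cL (clG Ea.1).
  by exists (size s) => //; split=> //; exact: coloring_alternations cs ca.
apply: bigcup_countable => // k _; apply: finite_set_countable.
apply: contrapT => infE; have [n nk] := ltn_expn2_mul k.
have [B BE Bn] := infinite_set_fset n infE.
pose s := take n (enum_fset B).
have ss : size s = n by rewrite size_takel.
have us : uniq s by rewrite take_uniq// fset_uniq.
have sE : [set` s] `<=` E `&` alternations_le k.
  by move=> a /= /mem_take; exact: BE.
suff : (2 ^ n <= n * k + 1)%N by rewrite leqNgt nk.
rewrite -ss; apply: (independent_alternations us); first by move=> a /sE[].
by apply: (@gap_independent p s us) => a /sE[[]].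
Qed.

(** This makes precise a point of [K] over [x]. The required closed sets have the finite
    intersection property by clause (2), because [x] realizes each finite pattern. *)
Lemma point_lift (x : L) : exists p : K, forall a, G a ->
  if `[< a x >] then (phi a).1 p else ~ (phi a).2 p.
Proof.
have [cptK _ K0] := cK.
have [|s us sG|p pP] := @compact_closed_bigcap K (set L) G
   (fun a => if `[< a x >] then (phi a).1 else ~` (phi a).2) cptK K0.
- by move=> a /phiP[c1 o2 _]; case: asboolP => // _; exact: open_closedC.
- have [_ _] := isoG.
  move=> /(_ [seq a <- s | `[< a x >]] [seq a <- s | ~~ `[< a x >]]).
  rewrite (perm_uniq (permEl (perm_filterC (fun a => `[< a x >]) s))).
  move=> /(_ us)[].
    by move=> a; rewrite /= (perm_mem (permEl (perm_filterC _ s))) => /sG.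
  move=> _ h; have : (\bigcap_(c in [set` [seq a <- s | `[< a x >]]]) (phi c).1 `\`
      \bigcup_(c in [set` [seq a <- s | ~~ `[< a x >]]]) (phi c).2) !=set0.
    apply/set0P/eqP => /h E; suff : set0 x by [].
    rewrite -E; split=> [a|[a + ax]]; rewrite /= mem_filter => /andP[].
      by move=> /asboolP.
    by move=> /asboolP.
  move=> [p [pa pb]]; exists p => a sa /=; case: asboolP => ax.
    by apply: pa; rewrite /= mem_filter sa andbT; apply/asboolP.
  move=> ap; apply: pb; exists a => //=; rewrite mem_filter sa andbT.
  exact/asboolP.
by exists p => a Ga; have := pP _ Ga; case: asboolP.
Qed.

Lemma separating_countable (x y : L) : separably_connected K ->
  countable [set a | G a /\ (a x <-> ~ a y)].
Proof.
move=> scK.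
suff sep (u v : L) : countable [set a | G a /\ a u /\ ~ a v].
  apply: (@sub_countable _ _ _ ([set a | G a /\ a x /\ ~ a y] `|`
                                [set a | G a /\ a y /\ ~ a x])).
    apply: subset_card_le => a [Ga xy].
    have [ax|nax] := pselect (a x); first by left; split=> //; split=> //; exact/xy.
    by right; split=> //; split=> //; apply: contrapT => nay; apply/nax/xy.
  by rewrite -bigcup2E; apply: bigcup_countable => // -[|[|n]] _ //=; exact: sep.
have [p pP] := point_lift u; have [q qP] := point_lift v.
have [S [Sp Sq cS [D [cD DS SD]]]] := scK p q.
(* Each separating gap is open and meets [S], hence contains a point of the countable dense set
   [D]. *)
apply: (@sub_countable _ _ _
  (\bigcup_(z in D) [set a | G a /\ ((phi a).2 `\` (phi a).1) z])); last first.
  by apply: bigcup_countable => // z _; exact: gap_countable.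
apply: subset_card_le => a [Ga [au nav]].
have ap : (phi a).1 p by have := pP _ Ga; case: asboolP.
have naq : ~ (phi a).2 q by have := qP _ Ga; case: asboolP.
have [z [Sz az]] := connected_meets_gap (phiP Ga) cS Sp Sq ap naq.
have := SD _ Sz ((phi a).2 `\` (phi a).1).
case.
  have [c1 o2 _] := phiP Ga.
  have : open ((phi a).2 `\` (phi a).1).
    by rewrite setDE; apply: openI => //; exact: closed_openC.
  by rewrite openE; exact.
by move=> w [Dw aw]; exists w.
Qed.

End SeparatingCountable.

(** * Auxiliary facts on clopen sets and countability *)

Lemma clopen_nbhs (T : topologicalType) (a : set T) (x : T) :
  clopen a -> nbhs x [set z | a z <-> a x].
Proof.
move=> [oa ca]; have [ax|nax] := pselect (a x).
  have : nbhs x a by move: oa; rewrite openE; exact.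
  by apply: filterS => z az.
have : nbhs x (~` a) by have := closed_openC ca; rewrite openE; exact.
by apply: filterS => z az.
Qed.

Lemma separates_pointsP X (G : set (set X)) (x y : X) :
  separates_points G -> x <> y -> exists2 a, G a & a x <-> ~ a y.
Proof.
move=> sepG xy; have [a Ga [z E]] := sepG _ _ xy; exists a => //.
split=> [ax ay|nay].
  have zx : x = z by have : (a `&` [set x; y]) x by [split=> //; left]; rewrite E.
  have zy : y = z by have : (a `&` [set x; y]) y by [split=> //; right]; rewrite E.
  by apply: xy; rewrite zx.
have [az [<-//|zy]] : (a `&` [set x; y]) z by rewrite E.
by rewrite zy in az.
Qed.

Lemma unit_itv_not_countable (R : realType) :
  ~ countable [set z : R | (0 < z < 1)%R].
Proof.
have -> : [set z : R | (0 < z < 1)%R] = `]0%R, 1%R[ by rewrite set_itvE.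
move=> /countable_lebesgue_measure0 /eqP.
by rewrite lebesgue_measure_itv /= lte_fin ltr01 oppr0 adde0 eqe oner_eq0.
Qed.

(** * The split interval *)

Section SplitInterval.
Context (R : realType) (ends : bool).
Let L := split_interval R ends.
Implicit Types p q : L.

Lemma split_interval_leE p q : (p <= q) =
  ((val p).1 < (val q).1)%R || ((val p).1 == (val q).1) && ((val p).2 ==> (val q).2).
Proof.
have -> : (p <= q) = (val p <= val q)%O by [].
by rewrite leEprodlexi leEbool; case: ltgtP => _ //=; case: (val p).2; case: (val q).2.
Qed.

Lemma split_interval_ltE p q : (p < q) =
  ((val p).1 < (val q).1)%R || ((val p).1 == (val q).1) && ~~ ((val q).2 ==> (val p).2).
Proof.
rewrite (ltNge p q) (split_interval_leE q p).
by case: (ltgtP (val p).1 (val q).1).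
Qed.

Lemma split_interval_val1_bounds p : (0 <= (val p).1 <= 1)%R.
Proof. by case: p => x /= /andP[]. Qed.

Lemma split_interval_interior (x : R) (b : bool) : (0 < x < 1)%R ->
  exists p : L, val p = (x, b).
Proof.
move=> /andP[x0 x1].
have P : split_interval_pred ends ((x, b) : (R *l bool)%type).
  rewrite /split_interval_pred /= !ltW//= !xpair_eqE.
  by rewrite (gt_eqF x0) (lt_eqF x1) /= orbT.
by exists (exist [eta split_interval_pred ends] _ P).
Qed.

Lemma split_interval_jump p q (x : R) :
  val p = (x, false) -> val q = (x, true) -> jump p q.
Proof.
move=> pE qE; split; first by rewrite split_interval_ltE pE qE /= eqxx orbT.
move=> r; rewrite !split_interval_leE pE qE /=.
by case: (ltgtP (val r).1 x) => _ /=; [left|right|case: (val r).2; [right|left]].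
Qed.

Lemma split_interval_jump_dense : jump_dense L.
Proof.
move=> p q; rewrite split_interval_ltE => /orP[pq|/andP[/eqP pq1 pq2]]; last first.
  exists p, q; split=> //; apply: (@split_interval_jump _ _ (val p).1).
    by case: (val p) pq2 => x [] //=; rewrite implybT.
  by rewrite pq1; case: (val q) pq2 => x [].
(* The midpoint is interior to the unit interval, so both of its copies exist whatever [ends] is. *)
have [pm mq] := midf_lt pq.
have m01 : (0 < ((val p).1 + (val q).1) / 2%:R < 1)%R.
  have /andP[p0 _] := split_interval_val1_bounds p.
  have /andP[_ q1] := split_interval_val1_bounds q.
  by rewrite (le_lt_trans p0 pm) (lt_le_trans mq q1).
have [u uE] := split_interval_interior false m01.
have [v vE] := split_interval_interior true m01.
exists u, v; split; first exact: split_interval_jump uE vE.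
  by rewrite split_interval_leE uE /= pm.
by rewrite split_interval_leE vE /= mq.
Qed.

Lemma split_interval_sup_complete : sup_complete L.
Proof.
move=> A; have [[q0 Aq0]|A0] := pselect (A !=set0); last first.
  (* The supremum of the empty set is the least point: (0, false), or (0, true) once the ends are
     removed. *)
  have P : split_interval_pred ends ((0%R, ~~ ends) : (R *l bool)%type).
    rewrite /split_interval_pred /= lexx ler01 /= !xpair_eqE eqxx.
    by rewrite (eq_sym 0%R 1%R) oner_eq0; case: ends.
  exists (exist [eta split_interval_pred ends] _ P) => p; split=> [_|_ q Aq]; last first.
    by case: A0; exists q.
  rewrite split_interval_leE /=.
  have /andP[] := split_interval_val1_bounds p; rewrite le_eqVlt => /orP[/eqP pE _|->//].
  rewrite -pE eqxx ltxx /=.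
  case: p pE => -[x b] /= + xE; rewrite /split_interval_pred -xE !xpair_eqE eqxx.
  by case: ends b => -[] //=; rewrite !andbF.
pose B := [set (val p).1 | p in A].
have Bq0 : B (val q0).1 by exists q0.
have supB : has_sup B.
  split; first by exists (val q0).1.
  by exists 1%R => _ [p _ <-]; case/andP: (split_interval_val1_bounds p).
set t := sup B.
have pt p : A p -> ((val p).1 <= t)%R.
  by move=> Ap; apply: sup_ubound; [exact: supB.2|exists p].
have t_le (y : R) : (forall p, A p -> ((val p).1 <= y)%R) -> (t <= y)%R.
  move=> Ay; apply: sup_le_ub; first exact: supB.1.
  by move=> _ [p Ap <-]; exact: Ay.
(* The upper copy of [t] is needed only if it belongs to [A]. *)
pose b := `[< exists2 p, A p & val p = (t, true) >].
have P : split_interval_pred ends ((t, b) : (R *l bool)%type).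
  apply/andP; split=> /=.
    rewrite (le_trans _ (pt _ Aq0)); last by case/andP: (split_interval_val1_bounds q0).
    by apply: t_le => p _; case/andP: (split_interval_val1_bounds p).
  case E : ends => //=; apply/andP; split; apply/eqP => -[t0].
    move=> /asboolP; apply; exists q0 => //.
    have /andP[x0 _] := split_interval_val1_bounds q0.
    have := pt _ Aq0; rewrite t0 => x0'.
    have xE : (val q0).1 = 0%R by apply/le_anti; rewrite x0 x0'.
    have : split_interval_pred ends (val q0) := valP q0.
    move: xE; case: (val q0) => x [] /= -> //.
    by rewrite /split_interval_pred E /= eqxx andbF.
  move=> /asboolP[p _ pE]; have : split_interval_pred ends (val p) := valP p.
  by rewrite /split_interval_pred pE t0 E /= eqxx !andbF.
exists (exist [eta split_interval_pred ends] _ P) => p; split=> [Ap|tp q Aq].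
  have : (t <= (val p).1)%R.
    apply: t_le => q /Ap; rewrite split_interval_leE.
    by move=> /orP[/ltW//|/andP[/eqP->]].
  rewrite split_interval_leE /= le_eqVlt => /orP[/eqP tE|->//].
  apply/orP; right; rewrite tE eqxx /=; apply/implyP => /asboolP[q Aq qE].
  by have := Ap _ Aq; rewrite split_interval_leE qE tE ltxx eqxx.
apply: le_trans tp; rewrite split_interval_leE /=.
have := pt _ Aq; rewrite le_eqVlt => /orP[/eqP qt|->//].
rewrite qt eqxx ltxx /=; apply/implyP => q2; apply/asboolP; exists q => //.
by move: qt q2 => /=; case: (sval q) => x c /= -> ->.
Qed.

Lemma split_interval_not_separable_image :
  ~ boolean_image_of_separably_connected L.
Proof.
move=> [K [cK scK [G [clG sepG [F FK [phi isoG]]]]]].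
have cL : compact [set: L].
  exact/sup_complete_compact/split_interval_sup_complete.
have [p0 _] := sup_complete_nonempty split_interval_sup_complete.
(* [sp] picks the point with given coordinates, with a junk value off the open unit interval. *)
have /choice[sp spP] (zb : R * bool) :
    exists p : L, (0 < zb.1 < 1)%R -> val p = (zb.1, zb.2).
  have [z01|nz] := boolP (0 < zb.1 < 1)%R.
    by have [p pE] := split_interval_interior zb.2 z01; exists p.
  by exists p0.
pose C (q : rat * rat) := [set a | G a /\
  (a (sp (ratr q.1, false)) <-> ~ a (sp (ratr q.2, false)))].
pose J (a : set L) := [set z : R | (0 < z < 1)%R /\
  (a (sp (z, false)) <-> ~ a (sp (z, true)))].
have spJ (z : R) : (0 < z < 1)%R -> jump (sp (z, false)) (sp (z, true)).
  by move=> z01; apply: (@split_interval_jump _ _ z); exact: spP.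
apply: (@unit_itv_not_countable R).
apply: (@sub_countable _ _ _
    (\bigcup_(q in [set: rat * rat]) \bigcup_(a in C q) J a)); last first.
  apply: bigcup_countable => // q _; apply: bigcup_countable.
    exact: (separating_countable cL cK clG isoG).
  move=> a [Ga _]; have [s [c [cs ca]]] := clopen_coloring cL (clG _ Ga).
  (* Jumps separated by [a] have left ends of distinct colours, so the index of the colour is
     injective on [J a]. *)
  apply/countable_injP; exists (fun z => index (c (sp (z, false))) s).
  suff lt_neq z z' : J a z -> J a z' -> (z < z')%R ->
      c (sp (z, false)) <> c (sp (z', false)).
    move=> z z' /set_mem Jz /set_mem Jz' /(index_inj p0 (cs _) (cs _)) cE.
    case: (ltgtP z z') => // zz'; first by case: (lt_neq z z').
    by case: (lt_neq z' z).
  move=> [z01 az] [z'01 _] zz' cE.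
  have : a (sp (z, false)) <-> a (sp (z, true)).
    apply: (ca _ _ _ cE); rewrite !split_interval_leE !spP//= zz' ltxx eqxx.
    by rewrite orbT.
  by tauto.
apply: subset_card_le => z z01.
have [uv _] := spJ _ z01.
have uv_neq : sp (z, false) <> sp (z, true) by move=> E; rewrite E ltxx in uv.
have [a Ga az] := separates_pointsP sepG uv_neq.
have /andP[z0 z1] := z01.
(* Since [a] is constant near each end of the jump at [z], rationals [q1] below and [q2] above [z]
   carry the same two values. The midpoints with 0 and 1 only supply points on each side, as the
   ends may be missing. *)
have [q1 [q101 aq1]] : exists q : rat, (0 < (ratr q : R) < 1)%R /\
    (a (sp (ratr q, false)) <-> a (sp (z, false))).
  have [z20 z2z] := midf_lt z0; rewrite add0r in z20 z2z.
  have z201 : (0 < z / 2%:R < 1)%R by rewrite z20 (lt_trans z2z).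
  have lt : sp ((z / 2%:R)%R, false) < sp (z, false).
    by rewrite split_interval_ltE !spP//= z2z.
  have [y yz ya] := nbhs_left (clopen_nbhs _ (clG _ Ga)) lt.
  have yz1 : ((val y).1 < z)%R.
    by move: yz; rewrite split_interval_ltE spP//= andbF orbF.
  have [q] := rat_in_itvoo yz1; rewrite in_itv /= => /andP[yq qz].
  have q01 : (0 < (ratr q : R) < 1)%R.
    have /andP[y0 _] := split_interval_val1_bounds y.
    by rewrite (le_lt_trans y0 yq) (lt_trans qz).
  exists q; split=> //; apply: ya.
  by rewrite /= split_interval_ltE split_interval_leE !spP//= yq qz.
have [q2 [q201 aq2]] : exists q : rat, (0 < (ratr q : R) < 1)%R /\
    (a (sp (ratr q, false)) <-> a (sp (z, true))).
  have [z2z z21] := midf_lt z1.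
  have z201 : (0 < (z + 1) / 2%:R < 1)%R by rewrite z21 (lt_trans z0).
  have lt : sp (z, true) < sp (((z + 1) / 2%:R)%R, false).
    by rewrite split_interval_ltE !spP//= z2z.
  have [y yz ya] := nbhs_right (clopen_nbhs _ (clG _ Ga)) lt.
  have yz1 : (z < (val y).1)%R.
    by move: yz; rewrite split_interval_ltE spP//= implybT andbF orbF.
  have [q] := rat_in_itvoo yz1; rewrite in_itv /= => /andP[zq qy].
  have q01 : (0 < (ratr q : R) < 1)%R.
    have /andP[_ y1] := split_interval_val1_bounds y.
    by rewrite (lt_trans z0 zq) (lt_le_trans qy).
  exists q; split=> //; apply: ya.
  by rewrite /= split_interval_ltE split_interval_leE !spP//= qy zq.
exists (q1, q2) => //; exists a; last by [].
by split=> //=; rewrite aq1 aq2.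
Qed.

End SplitInterval.

(** * The ordinal interval up to the first uncountable ordinal *)

Section Omega1Interval.
Context d (L : orderTopologicalType d) (t : L).
Hypotheses (wo : well_order (<=%O : rel L)) (t_max : forall x : L, x <= t).
Hypotheses (unc : ~ countable [set z : L | z < t])
           (cnt : forall x : L, x < t -> countable [set z : L | z < x]).

Let least (A : set L) : A !=set0 -> exists2 m, A m & lbound A m.
Proof.
move=> [x Ax]; have [|m [[mA mlb] _]] := wo (A := [pred y | `[< A y >]]).
  by exists x; apply/asboolP.
exists m; first by apply/asboolP.
by move=> y Ay; apply: mlb; apply/asboolP.
Qed.

Lemma well_order_sup_complete : sup_complete L.
Proof.
move=> A; have [|s As s_le] := @least (ubound A); first by exists t => x _.
exists s => y; split=> [/s_le//|sy x /As xs]; exact: le_trans sy.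
Qed.

Lemma well_order_jump_dense : jump_dense L.
Proof.
move=> x y xy; have [|v xv v_le] := @least [set z | x < z]; first by exists y.
exists x, v; split=> //; last exact: v_le.
by split=> // z; case: (leP z x) => [|xz]; [left|right; exact: v_le].
Qed.

(** This is the uncountable cofinality of omega_1: an unbounded countable [C] would cover everything
    below [t] by countably many countable initial segments. *)
Lemma countable_bounded (C : set L) : countable C -> (forall x, C x -> x < t) ->
  exists2 b, b < t & forall x, C x -> x < b.
Proof.
move=> cC Ct; apply: contrapT => nb; apply: unc.
apply: (@sub_countable _ _ _ (\bigcup_(x in C) ([set z | z < x] `|` [set x]))).
  apply: subset_card_le => y yt; apply: contrapT => ny; apply: nb.
  exists y => // x Cx; rewrite ltNge; apply/negP => yx; apply: ny.
  by exists x => //; move: yx; rewrite le_eqVlt => /orP[/eqP|]; [right|left].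
apply: bigcup_countable => // x Cx; rewrite -bigcup2E.
apply: bigcup_countable => // -[|[|n]] _ //=.
by apply: cnt; exact: Ct.
Qed.

Lemma omega1_not_separable_image :
  ~ boolean_image_of_separably_connected L.
Proof.
move=> [K [cK scK [G [clG sepG [F FK [phi isoG]]]]]].
have cL := sup_complete_compact well_order_sup_complete.
have [x0 x0t] : exists x0 : L, x0 < t.
  apply: contrapT => h; apply: unc.
  suff -> : [set z : L | z < t] = set0 by [].
  by apply/seteqP; split=> // z zt; apply: h; exists z.
(* Beyond [g a] the set [a] keeps its value at [t]. *)
have /choice[g gP] (a : set L) : exists b, G a ->
    b < t /\ forall z, b < z -> a z <-> a t.
  have [Ga|] := pselect (G a); last by exists x0.
  have [y yt ya] := nbhs_left (clopen_nbhs t (clG _ Ga)) x0t.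
  by exists y => _; split=> // z yz; apply: ya; rewrite /= yz t_max.
(* [f x] exceeds [x] and [g a] for the countably many [a] separating [x] from [t]. *)
have /choice[f fP] (x : L) : exists b, x < t -> [/\ b < t, x < b &
    forall a, G a -> (a x <-> ~ a t) -> forall z, b <= z -> a z <-> a t].
  have [xt|] := boolP (x < t); last by exists x0.
  have [||b bt Cb] := @countable_bounded
      (g @` [set a | G a /\ (a x <-> ~ a t)] `|` [set x]).
  - rewrite -bigcup2E; apply: bigcup_countable => // -[|[|n]] _ //=.
    apply: sub_countable (card_image_le _ _) _.
    exact: (separating_countable cL cK clG isoG).
  - by move=> _ [[a [Ga _] <-]|->//]; case: (gP a Ga).
  exists b => _; split=> //; first by apply: Cb; right.
  move=> a Ga axt z bz; have [_] := gP a Ga; apply.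
  by apply: lt_le_trans bz; apply: Cb; left; exists a.
pose al n := iter n f x0.
have al_lt n : al n < t by elim: n => //= n /fP[].
have al_inc n : al n < al n.+1 by have [] := fP _ (al_lt n).
have [s sP] := well_order_sup_complete (range al).
have al_le n : al n <= s by have /sP : s <= s by []; apply; exists n.
have st : s < t.
  have [||b bt alb] := @countable_bounded (range al).
  - by apply: sub_countable (card_image_le _ _) _.
  - by move=> _ [n _ <-].
  apply: le_lt_trans bt; apply/sP => _ [n _ <-]; apply/ltW/alb.
  by exists n.
have s_neq_t : s <> t by move=> E; rewrite E ltxx in st.
have [a Ga ast] := separates_pointsP sepG s_neq_t.
have x0s : x0 < s by apply: lt_le_trans (al_inc 0%N) (al_le 1%N).
have [y ys ya] := nbhs_left (clopen_nbhs s (clG _ Ga)) x0s.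
have [n yn] : exists n, y < al n.
  apply: contrapT => h; suff : s <= y by rewrite leNgt ys.
  by apply/sP => _ [n _ <-]; rewrite leNgt; apply/negP => yn; apply: h; exists n.
(* So [a] separates [al n] from [t], hence is constant from [al n.+1] on; as [s] lies there, [a]
   cannot separate [s] from [t]. *)
have an : a (al n) <-> a s by apply: ya; rewrite /= yn al_le.
have [_ _ /(_ a Ga _ s (al_le n.+1)) h] := fP _ (al_lt n).
by tauto.
Qed.

End Omega1Interval.

Theorem mainTheorem7 :
  (forall (R : realType) (ends : bool),
    let L := split_interval R ends in
    [/\ compact_space L, has_clopen_base L,
        boolean_image_of_connected L
      & ~ boolean_image_of_separably_connected L])
  /\
  (forall (d : Order.disp_t) (L : orderTopologicalType d),
    is_omega1_interval L ->
    [/\ compact_space L, has_clopen_base L,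
        boolean_image_of_connected L
      & ~ boolean_image_of_separably_connected L]).
Proof.
split=> [R ends L|d L [wo [t [t_max unc cnt]]]].
  have supL : sup_complete L := @split_interval_sup_complete R ends.
  have jumpL : jump_dense L := @split_interval_jump_dense R ends.
  split; [exact: sup_complete_compact_space|exact: jump_dense_clopen_base| |].
    exact: (jump_dense_connected_image R).
  exact: split_interval_not_separable_image.
have supL := well_order_sup_complete wo t_max.
have jumpL := well_order_jump_dense wo.
have unc' : ~ countable [set z : L | z < t] by rewrite set_itvE in unc.
have cnt' x : x < t -> countable [set z : L | z < x].
  by move=> /cnt; rewrite set_itvE.
split; [exact: sup_complete_compact_space|exact: jump_dense_clopen_base| |].
  (* The ordinal brings no reals of its own; any real type can fill its jumps. *)
  exact: (jump_dense_connected_image Rdefinitions.R).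
exact: (omega1_not_separable_image wo t_max unc' cnt').
Qed.
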